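(* Let $N\ge1$ be an integer and $x=[0;d_1,d_2,\ldots]_N\in[0,1]\setminus\mathbb{Q}$. The directive sequence $\boldsymbol{\sigma}_x=(\sigma_n)_{n\ge1}$ of NCF substitutions has a generalized right eigenvector given by the letter frequency vector $(f_0,f_1)=\left(\frac{1}{x+1},\frac{x}{x+1}\right)$ of $\omega(x,N)$.
   Context: Let $N\ge 1$ be an integer and define $T_N:[0,1]\to[0,1]$ by $T_N(x)=\frac{N}{x}-\lfloor\frac{N}{x}\rfloor$ for $x\ne0$ and $T_N(0)=0$. For $x\in[0,1]\setminus\mathbb{Q}$ the (greedy) NCF digits of $x$ are $d_n=\lfloor N/T_N^{n-1}(x)\rfloor\ge N$, $n\ge1$; one writes $x=[0;d_1,d_2,\ldots]_N$. The NCF substitutions of $x$ are $\sigma_n(0)=0^{d_n}1^N$, $\sigma_n(1)=0$, $n\ge1$, extended to finite and infinite words over $\{0,1\}$ by concatenation. Their incidence matrices $M_\sigma=(|\sigma(j)|_i)_{i,j\in\{0,1\}}$ (where $|u|_i$ is the number of occurrences of letter $i$ in $u$) are $M_{\sigma_n}=\begin{pmatrix}d_n&1\\N&0\end{pmatrix}$. The NCF sequence $\omega(x,N)$ is the unique $\omega\in\{0,1\}^{\mathbb{N}}$ for which there exist $\omega^{(1)},\omega^{(2)},\ldots\in\{0,1\}^{\mathbb{N}}$ with $\omega^{(1)}=\omega$ and $\omega^{(n)}=\sigma_n(\omega^{(n+1)})$ for all $n\ge1$. The frequency of a letter $a$ in a sequence is $f_a=\lim_{|p|\to\infty}\frac{|p|_a}{|p|}$,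 the limit being over prefixes $p$ of the sequence. Let $\mathbb{R}^2_+$ be the set of vectors in $\mathbb{R}^2$ with positive entries and $\mathbb{R}_+$ the positive reals. A vector $\mathbf{u}\in\mathbb{R}^2_+$ with $\|\mathbf{u}\|_1=1$ is a generalized right eigenvector of $(\sigma_n)_{n\ge1}$ if $\bigcap_{n\ge1}M_{\sigma_1}\cdots M_{\sigma_n}\mathbb{R}^2_+=\mathbb{R}_+\mathbf{u}$. *)

(* Defs.v *)
From HB Require Import structures.
From mathcomp Require Import all_boot all_order all_algebra.
From mathcomp Require Import all_classical all_reals all_analysis.

Set Implicit Arguments.
Unset Strict Implicit.
Unset Printing Implicit Defensive.

Import Order.TTheory GRing.Theory Num.Theory.
Import numFieldNormedType.Exports.

Local Open Scope classical_set_scope.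
Local Open Scope ring_scope.

Definition substitution := 'I_2 -> seq 'I_2.

Definition subst_word (s : substitution) (u : seq 'I_2) : seq 'I_2 :=
  flatten [seq s a | a <- u].

(* The image of an infinite word: for nonerasing s, the image of the prefix of
   length k + 1 is long enough to contain the k-th letter of s(w); see
   nth_subst_word below. *)
Definition subst_seq (s : substitution) (w : nat -> 'I_2) : nat -> 'I_2 :=
  fun k => nth ord0 (subst_word s (mkseq w k.+1)) k.

Definition incidence_mx (R : realType) (s : substitution) : 'M[R]_2 :=
  \matrix_(i, j) (count_mem i (s j))%:R.

(* Directive sequences are indexed from 0: s n stands for sigma_(n+1). *)
Definition is_directed_by (s : nat -> substitution) (w : nat -> 'I_2) : Prop :=
  exists W : nat -> nat -> 'I_2,
    W 0%N = w /\ forall n, W n = subst_seq (s n) (W n.+1).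

Definition pos_cone (R : realType) : set 'cV[R]_2 :=
  [set v | forall i, 0 < v i ord0].

Definition is_generalized_right_eigenvector (R : realType)
    (s : nat -> substitution) (u : 'cV[R]_2) : Prop :=
  [/\ pos_cone u,
      \sum_(i < 2) `|u i ord0| = 1 &
      \bigcap_(n in [set n | (1 <= n)%N])
        [set (\prod_(k < n) incidence_mx R (s k)) *m v | v in @pos_cone R]
      = [set c *: u | c in [set c : R | 0 < c]] ].

Definition has_frequency (R : realType) (w : nat -> 'I_2) (a : 'I_2) (f : R) :
    Prop :=
  (fun n => (count_mem a (mkseq w n))%:R / n%:R : R) @ \oo --> f.

Definition ncf_map (R : realType) (N : nat) (x : R) : R :=
  if x == 0 then 0 else N%:R / x - (Num.floor (N%:R / x))%:~R.

(* ncf_digit N x n is the digit d_(n+1); Num.truncn is the floor on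
   nonnegative reals. *)
Definition ncf_digit (R : realType) (N : nat) (x : R) (n : nat) : nat :=
  Num.truncn (N%:R / iter n (ncf_map N) x).

Definition ncf_subst (R : realType) (N : nat) (x : R) (n : nat) :
    substitution :=
  fun a => if a == ord0 then nseq (ncf_digit N x n) ord0 ++ nseq N ord_max
           else [:: ord0].

(* The unique sequence directed by the NCF substitutions of x; existence and
   uniqueness for N >= 1 and irrational x in [0, 1] are ncf_sequenceP and
   ncf_sequence_unique below. *)
Definition ncf_sequence (R : realType) (N : nat) (x : R) : nat -> 'I_2 :=
  xget (fun=> ord0) [set w | is_directed_by (ncf_subst N x) w].

Lemma subst_word_cat s u v :
  subst_word s (u ++ v) = subst_word s u ++ subst_word s v.
Proof. by rewrite /subst_word map_cat flatten_cat. Qed.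

Lemma size_subst_word (s : substitution) u :
  (forall a, (0 < size (s a))%N) -> (size u <= size (subst_word s u))%N.
Proof.
move=> hs; elim: u => //= a u IH.
by rewrite -cat1s /subst_word /= size_cat -add1n leq_add.
Qed.

Lemma mkseqD (w : nat -> 'I_2) m n :
  (m <= n)%N -> exists v, mkseq w n = mkseq w m ++ v.
Proof.
move=> mn; exists (drop m (mkseq w n)).
rewrite -{1}(cat_take_drop m (mkseq w n)); congr (_ ++ _).
by rewrite /mkseq -map_take take_iota (minn_idPl mn).
Qed.

Lemma nth_subst_word (s : substitution) (w : nat -> 'I_2) m k :
  (forall a, (0 < size (s a))%N) ->
  (k < size (subst_word s (mkseq w m)))%N ->
  nth ord0 (subst_word s (mkseq w m)) k = subst_seq s w k.
Proof.
move=> hs km; rewrite /subst_seq.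
have kk : (k < size (subst_word s (mkseq w k.+1)))%N.
  by apply: leq_trans (size_subst_word _ hs); rewrite size_mkseq.
have [mk|/ltnW mk] := leqP m k.+1; have [v ->] := mkseqD w mk.
  by rewrite subst_word_cat nth_cat km.
by rewrite subst_word_cat nth_cat kk.
Qed.

Section directed.
Variable s : nat -> substitution.
Hypothesis s_head : forall n a, exists t, s n a = ord0 :: t.
Hypothesis s_size : forall n, (1 < size (s n ord0))%N.

Fixpoint dir_word (n k : nat) : seq 'I_2 :=
  if k is k'.+1 then subst_word (s n) (dir_word n.+1 k') else [:: ord0].

Definition dir_lim n k := nth ord0 (dir_word n k) k.

Let s_gt0 n a : (0 < size (s n a))%N.
Proof. by have [t ->] := s_head n a. Qed.

Lemma dir_word_head n k : exists t, dir_word n k = ord0 :: t.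
Proof.
elim: k n => [|k IH] n /=; first by exists [::].
have [t ->] := IH n.+1; have [v hv] := s_head n ord0.
by rewrite /subst_word /= hv; eexists.
Qed.

Lemma dir_word_size n k : (k < size (dir_word n k))%N.
Proof.
elim: k n => [//|k IH] n; have := IH n.+1; have [t /= ->] := dir_word_head n.+1 k.
rewrite /subst_word /= size_cat ltnS => kt.
by rewrite -addn2 addnC leq_add// (leq_trans kt)// size_subst_word.
Qed.

Lemma dir_wordS n k : exists v, dir_word n k.+1 = dir_word n k ++ v.
Proof.
elim: k n => [|k IH] n.
  have [v hv] := s_head n ord0; exists v.
  by rewrite /= /subst_word /= cats0 hv.
have [v hv] := IH n.+1; exists (subst_word (s n) v).
by rewrite [LHS]/= -/(dir_word n.+1 k.+1) hv subst_word_cat.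
Qed.

Lemma dir_wordD n k l : (k <= l)%N ->
  exists v, dir_word n l = dir_word n k ++ v.
Proof.
move/subnKC <-; elim: (l - k)%N => [|j [v hv]].
  by exists [::]; rewrite addn0 cats0.
have [u hu] := dir_wordS n (k + j).
by exists (v ++ u); rewrite addnS hu hv catA.
Qed.

Lemma dir_limE n k i : (i < size (dir_word n k))%N ->
  nth ord0 (dir_word n k) i = dir_lim n i.
Proof.
move=> ik; rewrite /dir_lim; have ii := dir_word_size n i.
have [le|/ltnW le] := leqP i k; have [v ->] := dir_wordD n le.
  by rewrite nth_cat ii.
by rewrite nth_cat ik.
Qed.

Lemma mkseq_dir_lim n k : mkseq (dir_lim n) (size (dir_word n k)) = dir_word n k.
Proof.
apply: (@eq_from_nth _ ord0); rewrite size_mkseq// => i ik.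
by rewrite nth_mkseq// dir_limE.
Qed.

Lemma dir_lim_directed : is_directed_by s (dir_lim 0).
Proof.
exists dir_lim; split=> // n; apply/funext => i.
have ii : (i < size (dir_word n i.+1))%N by exact: ltnW (dir_word_size _ _).
rewrite -(dir_limE ii) /= -[in LHS](mkseq_dir_lim n.+1 i) nth_subst_word//.
by rewrite mkseq_dir_lim.
Qed.

Lemma directed_unique w : is_directed_by s w -> w = dir_lim 0.
Proof.
move=> [W [<- WE]].
suff H k n : mkseq (W n) (size (dir_word n k)) = dir_word n k.
  apply/funext => i; rewrite /dir_lim -(H i 0%N) nth_mkseq//.
  exact: dir_word_size.
elim: k n => [|k IH] n.
  rewrite /mkseq/= WE /subst_seq /subst_word/=.
  by have [t ->] := s_head n (W n.+1 0%N).
apply: (@eq_from_nth _ ord0); rewrite size_mkseq// => i ik.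
rewrite nth_mkseq// WE /= -(IH n.+1) nth_subst_word//.
by rewrite IH.
Qed.

End directed.

Section ncf_wf.
Variables (R : realType) (N : nat) (x : R).
Hypotheses (N1 : (1 <= N)%N) (x01 : 0 <= x <= 1) (xirr : irrational x).

Lemma ncf_map_irrational (y : R) : irrational y -> irrational (ncf_map N y).
Proof.
move=> yirr.
have y0 : y != 0.
  by apply/eqP => y0; apply: yirr; exists 0; rewrite ?y0 ?rmorph0.
rewrite /ncf_map (negbTE y0) => -[q _ qE]; apply: yirr.
exists (N%:R / (q + (Num.floor (N%:R / y))%:~R)) => //.
rewrite fmorph_div rmorphD/= ratr_nat ratr_int qE subrK invfM invrK mulrA.
by rewrite divff ?mul1r// pnatr_eq0 -lt0n.
Qed.

Lemma ncf_iter n : let y := iter n (ncf_map N) x in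
  irrational y /\ 0 < y <= 1.
Proof.
elim: n => [|n [yirr /andP[y0 _]]] /=.
  split=> //; case/andP: x01 => x0 ->; rewrite andbT lt_neqAle x0 andbT.
  by apply/eqP => y0; apply: xirr; exists 0; rewrite -?y0 ?rmorph0.
have zirr := ncf_map_irrational yirr; split=> //.
rewrite lt_neqAle eq_sym; apply/andP; split; [apply/andP; split|].
- by apply/eqP => z0; apply: zirr; exists 0; rewrite ?z0 ?rmorph0.
- by rewrite /ncf_map gt_eqF// subr_ge0 floor_le.
- rewrite /ncf_map gt_eqF// lerBlDr addrC.
  by have := floorD1_gt (N%:R / iter n (ncf_map N) x); rewrite intrD => /ltW.
Qed.

Lemma ncf_digit_ge n : (N <= ncf_digit N x n)%N.
Proof.
have [_ /andP[y0 y1]] := ncf_iter n.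
rewrite /ncf_digit truncn_ge_nat; last by rewrite divr_ge0 ?ler0n ?ltW.
by rewrite ler_pdivlMr// ler_piMr ?ler0n.
Qed.

Let ncf_head n a : exists t, ncf_subst N x n a = ord0 :: t.
Proof.
rewrite /ncf_subst; case: eqP => _; last by exists [::].
case: (ncf_digit N x n) (ncf_digit_ge n) => [|d _]; last by eexists.
by rewrite leqNgt N1.
Qed.

Let ncf_size n : (1 < size (ncf_subst N x n ord0))%N.
Proof.
rewrite /ncf_subst eqxx size_cat !size_nseq -[1%N.+1]/(1 + 1)%N leq_add//.
exact: leq_trans (ncf_digit_ge n).
Qed.

Lemma ncf_sequenceP : is_directed_by (ncf_subst N x) (ncf_sequence N x).
Proof.
exact: (@xgetI _ _ [set w | is_directed_by (ncf_subst N x) w] _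
  (dir_lim_directed ncf_head ncf_size)).
Qed.

Lemma ncf_sequence_unique w :
  is_directed_by (ncf_subst N x) w -> w = ncf_sequence N x.
Proof.
move=> /(directed_unique ncf_head ncf_size) ->.
by rewrite -(directed_unique ncf_head ncf_size ncf_sequenceP).
Qed.

End ncf_wf.

(* Main.v *)
Require Import Defs.
From HB Require Import structures.
From mathcomp Require Import all_boot all_order all_algebra.
From mathcomp Require Import all_classical all_reals all_analysis.
From mathcomp Require Import ring lra.

Set Implicit Arguments.
Unset Strict Implicit.
Unset Printing Implicit Defensive.

Import Order.TTheory GRing.Theory Num.Theory.
Import numFieldNormedType.Exports.

Local Open Scope classical_set_scope.
Local Open Scope ring_scope.

(** Both claims rest on the linear form [D_x(a, b) = b - x a], whose kernel is
    spanned by [(1, x)].  Since [N = x (d_1 + T x)], substituting by [sigma_1]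
    gives [D_x (M_1 v) = - x D_(T x) v], hence
    [|D_x (M_1 ... M_n v)| = c_n |D_(T^n x) v|] with
    [c_n = x (T x) ... (T^(n-1) x)].  As [y (T y) <= N / (N + 1)] along the
    orbit, [c_n] tends to [0].  Because [|D_x v|] is at most the l1-norm of [v],
    which the matrices do not decrease on the cone, a vector in every cone
    satisfies [D_x v = 0]; and a prefix of [omega], being an [n]-fold image up
    to a bounded remainder, has [D_x] at most [c_n] times its length, plus a
    constant. *)

(** * Words over two letters and desubstitution of prefixes *)

Lemma ord2E (a : 'I_2) : a = ord0 \/ a = ord_max.
Proof. by case: a => [[|[|//]] h]; [left|right]; apply: val_inj. Qed.

Lemma sum_ord2 (V : nmodType) (F : 'I_2 -> V) :
  \sum_(i < 2) F i = F ord0 + F ord_max.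
Proof.
by rewrite big_ord_recl big_ord1; congr (_ + F _); apply: val_inj.
Qed.

Lemma count_ord2 (u : seq 'I_2) :
  (count_mem ord0 u + count_mem ord_max u)%N = size u.
Proof.
rewrite -(count_predC (pred1 ord0)); congr addn; apply: eq_count => a /=.
by case: (ord2E a) => ->.
Qed.

(** Take [k] maximal such that the image of the prefix of length [k] fits into length [m]. What
    remains is shorter than the image of the next letter. *)
Lemma mkseq_subst_seq (s : substitution) (w : nat -> 'I_2) (B m : nat) :
  (forall a, (0 < size (s a) <= B)%N) ->
  exists k r, [/\ (k <= m)%N, (size r <= B)%N &
    mkseq (subst_seq s w) m = subst_word s (mkseq w k) ++ r].
Proof.
move=> hs; have s0 a : (0 < size (s a))%N by case/andP: (hs a).
pose P k := (size (subst_word s (mkseq w k)) <= m)%N.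
have P0 : exists k, P k by exists 0%N.
have Pm k : P k -> (k <= m)%N.
  by apply: leq_trans; have := size_subst_word (mkseq w k) s0; rewrite size_mkseq.
case: (ex_maxnP P0 Pm) => k Pk kmax.
have E : mkseq (subst_seq s w) (size (subst_word s (mkseq w k))) =
    subst_word s (mkseq w k).
  apply: (@eq_from_nth _ ord0); rewrite size_mkseq// => i ik.
  by rewrite nth_mkseq// nth_subst_word.
have [r hr] := mkseqD (subst_seq s w) Pk.
exists k, r; split; [exact: Pm| |by rewrite hr E].
have := congr1 size hr; rewrite size_cat !size_mkseq => mE.
have : ~~ P k.+1 by apply/negP => /kmax; rewrite ltnn.
rewrite /P -ltnNge mkseqS -cats1 subst_word_cat size_cat mE ltn_add2l.
rewrite /subst_word/= cats0 => /ltnW /leq_trans; apply.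
by case/andP: (hs (w k)).
Qed.

(** * Orbits of the NCF map and products of orbit points *)

Section ncf.
Variables (R : realType) (N : nat).
Hypothesis N1 : (1 <= N)%N.

(** This set is stable under [ncf_map N], so inductions can peel off the first digit and continue at
    the image of [x]. *)
Definition ncf_dom : set R := [set x | 0 <= x <= 1 /\ irrational x].

Lemma ncf_dom_gt0 x : ncf_dom x -> 0 < x.
Proof. by case=> x01 xirr; have [_ /andP[]] := ncf_iter N1 x01 xirr 0. Qed.

Lemma ncf_dom_le1 x : ncf_dom x -> x <= 1.
Proof. by case=> /andP[]. Qed.

Lemma ncf_dom_map x : ncf_dom x -> ncf_dom (ncf_map N x).
Proof.
case=> x01 xirr; have [yirr /andP[y0 y1]] := ncf_iter N1 x01 xirr 1.
by split=> //; rewrite ltW.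
Qed.

Lemma ncf_mapE x : ncf_dom x ->
  N%:R = x * ((ncf_digit N x 0)%:R + ncf_map N x) :> R.
Proof.
move=> xd; have x0 := ncf_dom_gt0 xd.
have q0 : 0 <= N%:R / x by rewrite divr_ge0 ?ler0n ?ltW.
rewrite /ncf_map gt_eqF// /ncf_digit/= truncn_floor q0.
rewrite natr_absz ger0_norm ?floor_ge0// [_ + (_ - _)]addrC subrK.
by rewrite mulrC divfK// gt_eqF.
Qed.

Lemma ncf_substS (x : R) n : ncf_subst N x n.+1 = ncf_subst N (ncf_map N x) n.
Proof. by rewrite /ncf_subst /ncf_digit iterSr. Qed.

Definition ncf_orbit_prod (x : R) n := \prod_(k < n) iter k (ncf_map N) x.

Lemma ncf_orbit_prodS x n :
  ncf_orbit_prod x n.+1 = x * ncf_orbit_prod (ncf_map N x) n.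
Proof.
rewrite /ncf_orbit_prod big_ord_recl; congr (_ * _).
by apply: eq_bigr => k _; rewrite lift0 iterSr.
Qed.

Lemma ncf_orbit_prod_ge0 x n : ncf_dom x -> 0 <= ncf_orbit_prod x n.
Proof.
elim: n x => [|n IH] x xd; first by rewrite /ncf_orbit_prod big_ord0.
by rewrite ncf_orbit_prodS mulr_ge0 ?IH ?(ltW (ncf_dom_gt0 xd))//; apply: ncf_dom_map.
Qed.

(** A single orbit point may be arbitrarily close to 1, so factors are bounded in pairs. With
    [y = T x], the product is [N y / (d_1 + y)], and [d_1 >= N], [y <= 1] give the bound. *)
Lemma ncf_mul_map_le x : ncf_dom x -> x * ncf_map N x <= N%:R / (N%:R + 1).
Proof.
move=> xd; have E := ncf_mapE xd; have x0 := ncf_dom_gt0 xd.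
have y1 := ncf_dom_le1 (ncf_dom_map xd).
have dN : N%:R <= (ncf_digit N x 0)%:R :> R.
  by case: xd => ? ?; rewrite ler_nat ncf_digit_ge.
have N0 : 0 <= N%:R :> R by rewrite ler0n.
rewrite ler_pdivlMr; last by lra.
by rewrite {2}E -mulrA ler_pM2l//; nra.
Qed.

Lemma ncf_orbit_prod_double x m : ncf_dom x ->
  ncf_orbit_prod x m.*2 <= (N%:R / (N%:R + 1)) ^+ m.
Proof.
elim: m x => [|m IH] x xd; first by rewrite /ncf_orbit_prod big_ord0 expr0.
have d1 := ncf_dom_map xd; have d2 := ncf_dom_map d1.
rewrite doubleS !ncf_orbit_prodS mulrA exprS ler_pM ?IH ?ncf_mul_map_le//.
  by rewrite mulr_ge0// ltW// ncf_dom_gt0.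
exact: ncf_orbit_prod_ge0.
Qed.

Lemma ncf_orbit_prod_small x (e : R) : ncf_dom x -> 0 < e ->
  exists n, ncf_orbit_prod x n < e.
Proof.
move=> xd e0; have N0 : 0 <= N%:R :> R by rewrite ler0n.
have q1 : `|N%:R / (N%:R + 1)| < 1 :> R.
  rewrite ger0_norm; last by rewrite divr_ge0//; lra.
  by rewrite ltr_pdivrMr; lra.
have /cvgrPdist_lt/(_ e e0)[m _ /(_ m (leqnn m))/=] := cvg_expr q1.
rewrite sub0r normrN => mE; exists m.*2.
apply: le_lt_trans (ncf_orbit_prod_double m xd) _.
exact: le_lt_trans (ler_norm _) mE.
Qed.

(** * The linear form and the action of one substitution *)

Definition defect (x a b : R) := b - x * a.

(** Stated on scalars, so that it applies both to entries of vectors and to letter counts. *)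
Lemma defect_step x a b : ncf_dom x ->
  defect x ((ncf_digit N x 0)%:R * a + b) (N%:R * a) =
  - x * defect (ncf_map N x) a b.
Proof. by move=> xd; rewrite /defect {1}(ncf_mapE xd); ring. Qed.

Lemma defect_le x a b : ncf_dom x -> 0 <= a -> 0 <= b ->
  `|defect x a b| <= a + b.
Proof.
move=> xd a0 b0; have x0 := ncf_dom_gt0 xd; have x1 := ncf_dom_le1 xd.
by rewrite ler_norml /defect; apply/andP; split; nra.
Qed.

Lemma incidence_ncfE (x : R) n (v : 'cV[R]_2) :
  (incidence_mx R (ncf_subst N x n) *m v) ord0 ord0 =
    (ncf_digit N x n)%:R * v ord0 ord0 + v ord_max ord0 /\
  (incidence_mx R (ncf_subst N x n) *m v) ord_max ord0 = N%:R * v ord0 ord0.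
Proof.
rewrite !mxE !sum_ord2 !mxE /ncf_subst/= !count_cat !count_nseq/=.
by rewrite mul0n !mul1n !addn0 mul1r mul0r addr0.
Qed.

Lemma count_ncf_subst (x : R) n (u : seq 'I_2) :
  count_mem ord0 (subst_word (ncf_subst N x n) u) =
    (ncf_digit N x n * count_mem ord0 u + count_mem ord_max u)%N /\
  count_mem ord_max (subst_word (ncf_subst N x n) u) =
    (N * count_mem ord0 u)%N.
Proof.
elim: u => [|a u [IH0 IH1]]; first by rewrite /= !muln0.
rewrite -cat1s subst_word_cat !count_cat IH0 IH1 /subst_word/=.
rewrite /ncf_subst; case: (ord2E a) => ->/=.
  rewrite !count_cat !count_nseq/= !mul0n !mul1n !addn0 !add0n.
  by rewrite !mulnDr !muln1 addnA.
by rewrite !add0n addnCA.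
Qed.

(** * Products of incidence matrices on the positive cone *)

Definition ncf_mx (x : R) n : 'M[R]_2 :=
  \prod_(k < n) incidence_mx R (ncf_subst N x k).

Lemma ncf_mx0 x : ncf_mx x 0 = 1%:M.
Proof. by rewrite /ncf_mx big_ord0. Qed.

Lemma ncf_mxS x n :
  ncf_mx x n.+1 = incidence_mx R (ncf_subst N x 0) *m ncf_mx (ncf_map N x) n.
Proof.
rewrite /ncf_mx big_ord_recl; congr (_ *m _).
by apply: eq_bigr => k _; rewrite lift0 ncf_substS.
Qed.

Lemma ncf_mx_pos x n (v : 'cV[R]_2) : ncf_dom x -> pos_cone v ->
  pos_cone (ncf_mx x n *m v).
Proof.
elim: n x => [|n IH] x xd vp; first by rewrite ncf_mx0 mul1mx.
have {}IH := IH _ (ncf_dom_map xd) vp.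
rewrite ncf_mxS -mulmxA => i.
have [E0 E1] := incidence_ncfE x 0 (ncf_mx (ncf_map N x) n *m v).
have N0 : 0 < N%:R :> R by rewrite ltr0n.
case: (ord2E i) => ->; rewrite ?E0 ?E1; last by rewrite mulr_gt0.
by rewrite ltr_wpDl// mulr_ge0// ?ler0n// ltW.
Qed.

(** The bound uses the norm of the image [w], not of [v]: for a vector in all the cones, [w] is
    fixed while its preimage varies with [n]. The norm does not decrease because the column sums
    [d + N] and 1 are at least 1. *)
Lemma defect_ncf_mx x n (v : 'cV[R]_2) : ncf_dom x -> pos_cone v ->
  let w := ncf_mx x n *m v in
  `|defect x (w ord0 ord0) (w ord_max ord0)| <=
    ncf_orbit_prod x n * (w ord0 ord0 + w ord_max ord0).
Proof.
move=> + vp; elim: n x => [|n IH] x xd /=.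
  rewrite ncf_mx0 mul1mx /ncf_orbit_prod big_ord0 mul1r.
  by apply: defect_le => //; apply: ltW.
have xd' := ncf_dom_map xd; have {}IH := IH _ xd'.
have wp := ncf_mx_pos n xd' vp.
rewrite ncf_mxS -mulmxA; move: (ncf_mx (ncf_map N x) n *m v) IH wp => w IH wp.
have [-> ->] := incidence_ncfE x 0 w.
have x0 := ncf_dom_gt0 xd.
rewrite defect_step// normrM normrN (gtr0_norm x0) ncf_orbit_prodS -mulrA.
rewrite ler_pM2l//; apply: le_trans IH _.
rewrite ler_wpM2l ?ncf_orbit_prod_ge0//.
have N0 : 1 <= N%:R :> R by rewrite ler1n.
have d0 : 0 <= (ncf_digit N x 0)%:R :> R by rewrite ler0n.
have dN : 1 <= (ncf_digit N x 0)%:R :> R.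
  by case: xd => ? ?; rewrite ler1n (leq_trans N1)// ncf_digit_ge.
have := wp ord0; have := wp ord_max; nra.
Qed.

(** The first matrix maps the ray of slope [T x] onto the ray of slope [x], so preimages can be
    taken one matrix at a time within the cone. *)
Lemma ncf_mx_surj x n (v : 'cV[R]_2) : ncf_dom x -> 0 < v ord0 ord0 ->
  v ord_max ord0 = x * v ord0 ord0 ->
  exists2 w, pos_cone w & ncf_mx x n *m w = v.
Proof.
elim: n x v => [|n IH] x v xd v0 vE; have x0 := ncf_dom_gt0 xd.
  exists v; last by rewrite ncf_mx0 mul1mx.
  by move=> i; case: (ord2E i) => ->//; rewrite vE mulr_gt0.
have N0 : 0 < N%:R :> R by rewrite ltr0n.
(* The second row forces [N c = x v_0]; the first row then holds because [N = x (d_1 + T x)]. *)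
pose c := x * v ord0 ord0 / N%:R.
pose v' : 'cV[R]_2 := \col_i (if i == ord0 then c else ncf_map N x * c).
have [||w wp wE] := IH _ v' (ncf_dom_map xd).
- by rewrite mxE/= divr_gt0 ?mulr_gt0.
- by rewrite !mxE.
exists w => //; rewrite ncf_mxS -mulmxA wE.
have [E0 E1] := incidence_ncfE x 0 v'.
have cE : N%:R * c = x * v ord0 ord0 by rewrite mulrC divfK ?gt_eqF.
apply/matrixP => i j; rewrite ord1; case: (ord2E i) => ->.
  rewrite E0 !mxE/= -mulrDl; apply: (mulfI (lt0r_neq0 x0)).
  by rewrite mulrA -ncf_mapE.
by rewrite E1 !mxE/= cE vE.
Qed.

(** * Letter counts in prefixes of a directed sequence *)

Lemma defect_prefix n x (W : nat -> nat -> 'I_2) : ncf_dom x ->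
  (forall k, W k = subst_seq (ncf_subst N x k) (W k.+1)) ->
  exists C, forall m, let p := mkseq (W 0) m in
    `|defect x (count_mem ord0 p)%:R (count_mem ord_max p)%:R| <=
      ncf_orbit_prod x n * m%:R + C.
Proof.
have defect_size y (u : seq 'I_2) : ncf_dom y ->
    `|defect y (count_mem ord0 u)%:R (count_mem ord_max u)%:R| <= (size u)%:R.
  by move=> yd; rewrite -count_ord2 natrD defect_le ?ler0n.
elim: n x W => [|n IH] x W xd WE.
  exists 0 => m /=; rewrite /ncf_orbit_prod big_ord0 mul1r addr0.
  by apply: le_trans (defect_size _ _ xd) _; rewrite size_mkseq.
have xd' := ncf_dom_map xd; have x0 := ncf_dom_gt0 xd.
have [|C hC] := IH _ (fun k => W k.+1) xd'.
  by move=> k; rewrite WE ncf_substS.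
(* [B] bounds the lengths of both letter images, hence the remainder. The earlier constant [C] is
   scaled by [x] when one substitution is applied. *)
pose B := (ncf_digit N x 0 + N)%N.
exists (x * C + B%:R) => m /=; rewrite WE.
have [|k [r [km rB ->]]] := @mkseq_subst_seq (ncf_subst N x 0) (W 1) B m.
  move=> a; rewrite /ncf_subst; case: eqP => _ /=.
    by rewrite size_cat !size_nseq leqnn addn_gt0 N1 orbT.
  by rewrite addn_gt0 N1 orbT.
have [c0 c1] := count_ncf_subst x 0 (mkseq (W 1) k).
rewrite !count_cat c0 c1.
set u := mkseq (W 1) k.
have -> : defect x
    (ncf_digit N x 0 * count_mem ord0 u + count_mem ord_max u
      + count_mem ord0 r)%:R
    (N * count_mem ord0 u + count_mem ord_max r)%:R =
  - x * defect (ncf_map N x) (count_mem ord0 u)%:R (count_mem ord_max u)%:R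
  + defect x (count_mem ord0 r)%:R (count_mem ord_max r)%:R.
  by rewrite -defect_step// /defect !natrD !natrM; ring.
apply: le_trans (ler_normD _ _) _; rewrite addrA; apply: lerD.
  rewrite normrM normrN (gtr0_norm x0) ncf_orbit_prodS -mulrA -mulrDr ler_pM2l//.
  apply: le_trans (hC k) _.
  by rewrite lerD2r ler_wpM2l ?ler_nat// ncf_orbit_prod_ge0.
by apply: le_trans (defect_size _ _ xd) _; rewrite ler_nat.
Qed.

Lemma defect_prefix_cvg x (w : nat -> 'I_2) : ncf_dom x ->
  is_directed_by (ncf_subst N x) w ->
  (fun m => defect x (count_mem ord0 (mkseq w m))%:R
    (count_mem ord_max (mkseq w m))%:R / m%:R) @ \oo --> (0 : R).
Proof.
move=> xd [W [<- WE]]; apply/cvgrPdist_lt => e e0.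
(* First [n] is fixed so that the linear term is below [e / 2] per letter; only then is [m] taken
   large enough to absorb [C], which depends on [n]. *)
have [n nE] := ncf_orbit_prod_small xd (divr_gt0 e0 (ltr0n _ 2)).
have [C hC] := defect_prefix n xd WE.
near=> m.
have m0 : 0 < m%:R :> R by near: m; exact: nbhs_infty_gtr.
have mC : C / (e / 2) < m%:R by near: m; exact: nbhs_infty_gtr.
rewrite sub0r normrN normrM normfV (gtr0_norm m0) ltr_pdivrMr//.
apply: le_lt_trans (hC m) _.
rewrite ltr_pdivrMr ?divr_gt0// in mC.
by nra.
Unshelve. all: by end_near. Qed.

End ncf.

Theorem lemma3p6 (R : realType) (N : nat) (x : R) :
  (1 <= N)%N -> 0 <= x <= 1 -> irrational x ->
  let f : 'cV[R]_2 :=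
    \col_(i < 2) (if i == ord0 then 1 / (x + 1) else x / (x + 1)) in
  (forall a : 'I_2, has_frequency (ncf_sequence N x) a (f a ord0)) /\
  is_generalized_right_eigenvector (ncf_subst N x) f.
Proof.
move=> N1 x01 xirr f; have xd : ncf_dom x by [].
have x0 := ncf_dom_gt0 N1 xd.
have x1 : x + 1 != 0 by rewrite gt_eqF//; lra.
have f0 : f ord0 ord0 = 1 / (x + 1) by rewrite mxE.
have f1 : f ord_max ord0 = x / (x + 1) by rewrite mxE.
have fp : pos_cone f.
  by move=> i; case: (ord2E i) => ->; rewrite ?f0 ?f1 divr_gt0//; lra.
split.
  have /(defect_prefix_cvg N1 xd) := ncf_sequenceP N1 x01 xirr.
  set w := ncf_sequence N x; set D := (X in X @ \oo) => D0 a.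
  (* As the two counts sum to [m], solving for them gives the proportions [(1 - D m) / (x + 1)] and
     [(x + D m) / (x + 1)]. *)
  pose c : R := if a == ord0 then - (x + 1)^-1 else (x + 1)^-1.
  have cD : (fun m => f a ord0 + c * D m) @ \oo --> f a ord0.
    rewrite -[X in _ --> X]addr0 -(mulr0 c).
    by apply: cvgD; [exact: cvg_cst|apply: cvgM => //; exact: cvg_cst].
  (* The equality is only eventual: at [m = 0] the quotients are 0 by convention. *)
  apply: cvg_trans cD; apply: near_eq_cvg; near=> m.
  have m0 : m%:R != 0 :> R.
    by rewrite gt_eqF//; near: m; exact: nbhs_infty_gtr.
  have mE := congr1 (fun k => k%:R : R) (count_ord2 (mkseq w m)).
  rewrite /= size_mkseq natrD in mE.
  rewrite /D /c /defect; case: (ord2E a) => ->; rewrite ?f0 ?f1/=;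
    rewrite -mE in m0 *; field; exact/andP.
split=> //.
  by rewrite sum_ord2 !gtr0_norm// f0 f1; field.
apply/seteqP; split=> [v vP|_ [c c0 <-] n _] /=; last first.
  apply: ncf_mx_surj => //; rewrite !mxE/=; first by rewrite mulr_gt0// divr_gt0//; lra.
  by field.
have vp : pos_cone v.
  by have [w wp <-] := vP 1%N isT; exact: ncf_mx_pos.
have vD n : `|defect x (v ord0 ord0) (v ord_max ord0)| <=
    ncf_orbit_prod N x n * (v ord0 ord0 + v ord_max ord0).
  (* The intersection starts at [n = 1], but [ncf_orbit_prod_small] may return 0, so that case is
     bounded directly. *)
  case: n => [|n].
    by rewrite /ncf_orbit_prod big_ord0 mul1r (defect_le N1)// ltW.
  by have [w wp <-] := vP n.+1 isT; exact: defect_ncf_mx.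
have vs : 0 < v ord0 ord0 + v ord_max ord0 by rewrite addr_gt0.
have /eqP : defect x (v ord0 ord0) (v ord_max ord0) = 0.
  apply/eqP; rewrite -normr_eq0 eq_le normr_ge0 andbT leNgt; apply/negP => D0.
  have [n] := ncf_orbit_prod_small N1 xd (divr_gt0 D0 vs).
  by rewrite ltr_pdivlMr// ltNge vD.
rewrite subr_eq0 => /eqP vE.
(* This scalar is the l1-norm of [v], as [v] has slope [x]. *)
exists (v ord0 ord0 * (x + 1)); first by rewrite /= mulr_gt0//; lra.
apply/matrixP => i j; have -> : j = ord0 by exact: ord1.
rewrite mxE; case: (ord2E i) => ->.
  by rewrite f0; field.
by rewrite f1 vE; field.
Unshelve. all: by end_near. Qed.
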